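(* Let $\mathcal{E}=(E,\ast)$ be a finite biordered set and $D$ a regular $\mathscr{D}$-class of $\mathsf{IG}(\mathcal{E})$, with Rees matrix coordinatisation $\varphi:D^0\to\mathcal{M}^0[G;I,\Lambda;P]$, and let $\overline\varphi(w)=\varphi(\overline{w})$ for words $w\in E^+$ with $\overline w\in D$. Let $w\in E^+$ be such that $\overline{w}\in D$ is a regular element of $\mathsf{IG}(\mathcal{E})$, and let $w=ue_{i\lambda}v$ be a factorisation of $w$ determining the position of a seed of $w$, so that $\overline{e_{i\lambda}}\in D$ and $\overline{ue_{i\lambda}}\;\mathscr{L}\;\overline{e_{i\lambda}}\;\mathscr{R}\;\overline{e_{i\lambda}v}$. Furthermore, let $u=g_1\dots g_k$ and $v=h_1\dots h_l$ for $g_p,h_q\in E$, $1\leqslant p\leqslant k$, $1\leqslant q\leqslant l$. Then $$\overline\varphi(w) = \left(i_1,\; f_{i_1\mu_1}f_{i_2\mu_1}^{-1}\dots f_{i_k\mu_k}f_{i\mu_k}^{-1}\, f_{i\lambda}\, f_{j_1\lambda}^{-1}f_{j_1\lambda_1}\dots f_{j_l\lambda_{l-1}}^{-1}f_{j_l\lambda_l},\; \lambda_l\right),$$ where $\lambda_1=\lambda\tau_{h_1}$, $\lambda_{q+1}=\lambda_q\tau_{h_{q+1}}$ for $1\leqslant q<l$, $j_q\in\mathrm{fix}(\sigma_{h_q})$ for $1\leqslant q\leqslant l$, $i_k=\sigma_{g_k}i$, $i_p=\sigma_{g_p}i_{p+1}$ for $1\leqslant p<k$, and $\mu_p\in\mathrm{fix}(\tau_{g_p})$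 for $1\leqslant p\leqslant k$.
   Context: For a semigroup $S$ with set of idempotents $E=E(S)$, the biordered set of $S$ is the partial algebra $\mathcal{E}_S=(E,\ast)$ in which $e\ast f$ is defined, and equal to $ef$, exactly when $\{e,f\}$ is a basic pair, i.e. $\{e,f\}\cap\{ef,fe\}\neq\varnothing$. A biordered set is a partial algebra isomorphic to some $\mathcal{E}_S$; it is finite if $E$ is finite. $\mathsf{IG}(\mathcal{E})$ is the semigroup presented by generators $\overline{E}=\{\overline{e}: e\in E\}$ and relations $\overline{e}\,\overline{f}=\overline{e\ast f}$ for all basic pairs $\{e,f\}$. For $w\in E^+$ (the free semigroup), $\overline{w}$ is its image in $\mathsf{IG}(\mathcal{E})$; $E^\ast$ is the free monoid. It is known that the idempotents of $\mathsf{IG}(\mathcal{E})$ are exactly the $\overline{e}$, $e\in E$, and that $e\mapsto\overline e$ is an isomorphism of biordered sets. Green's relations below are taken in $\mathsf{IG}(\mathcal{E})$. A $\mathscr{D}$-class is regular if it contains an idempotent. If $\overline w$ is regular, a seed of $w$ is a letter $e\in E$ occurring in a factorisation $w=uev$ ($u,v\in E^\ast$) with $\overline{ue}\;\mathscr{L}\;\overline{e}\;\mathscr{R}\;\overline{ev}$; then $\overline e\;\mathscr{D}\;\overline w$. Coordinatisation. Let $D$ be a regular $\mathscr{D}$-class. As $E$ is finite, $D$ is a $\mathscr{J}$-class and its principal factor $D^0=D\cup\{0\}$ (product as in $\mathsf{IG}(\mathcal{E})$ if the result lies in $D$, and $0$ otherwise) is completely $0$-simple. Let $I$, $\Lambda$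 index the $\mathscr{R}$-classes $R_i$ and $\mathscr{L}$-classes $L_\lambda$ of $D$. If $R_i\cap L_\lambda$ contains an idempotent, that idempotent is denoted $\overline{e_{i\lambda}}$, $e_{i\lambda}\in E$. The map $\varphi:D^0\to\mathcal{M}^0[G;I,\Lambda;P]$ is an isomorphism onto a Rees matrix semigroup, with $\varphi^{-1}(i,g,\lambda)\in R_i\cap L_\lambda$, where multiplication is $(i,g,\lambda)(j,h,\mu)=(i,gp_{\lambda j}h,\mu)$ if $p_{\lambda j}\ne0$ and $0$ otherwise. Here $G$ is isomorphic to the maximal subgroups of $D$ and is given by a finite presentation, computable from $\mathcal{E}$, in terms of generators $f_{i\lambda}$ for those $(i,\lambda)$ such that $R_i\cap L_\lambda$ contains an idempotent, in which case $p_{\lambda i}=f_{i\lambda}^{-1}$; otherwise $p_{\lambda i}=0$. Thus $\varphi(\overline{e_{i\lambda}})=(i,f_{i\lambda},\lambda)$. Partial maps. For $e\in E$, $\tau_e$ is the partial map on $\Lambda$ (written on the right) with $\lambda\tau_e=\lambda'$ whenever $[\varphi^{-1}(i,g,\lambda)]\overline{e}=\varphi^{-1}(i,h,\lambda')\in D$ for some $i\in I$, $g,h\in G$; $\sigma_e$ is the partial map on $I$ (written on the left) with $\sigma_e i=i'$ whenever $\overline{e}[\varphi^{-1}(i,g,\lambda)]=\varphi^{-1}(i',h,\lambda)\in D$ for some $\lambda\in\Lambda$, $g,h\in G$. These are well-defined idempotent partial maps, and $\mathrm{fix}(\alpha)$ denotes the set of fixed points of a partial map $\alpha$. *)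

(* Defs.v *)
From HB Require Import structures.
From mathcomp Require Import all_boot all_fingroup.
From mathcomp Require Import boolp classical_sets.

Set Implicit Arguments.
Unset Strict Implicit.
Unset Printing Implicit Defensive.

Local Open Scope group_scope.
Local Open Scope quotient_scope.
Local Open Scope classical_set_scope.

(** * Biordered sets *)

Definition idempotent_elt (S : semigroupType) (x : S) := x * x = x.

Definition basic_pair (S : semigroupType) (e f : S) :=
  [\/ e * f = e, e * f = f, f * e = e | f * e = f].

(* The partial operation is [star], with [star e f = None] when [e * f] is
   undefined.  The map [iota] is an isomorphism of partial algebras from
   [(E, star)] onto the biordered set of the semigroup [S]. *)
Definition is_biordered (E : Type) (star : E -> E -> option E) :=
  exists (S : semigroupType) (iota : E -> S),
    [/\ injective iota,
        range iota = [set x | idempotent_elt x]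
      & forall e f g, star e f = Some g <->
          basic_pair (iota e) (iota f) /\ iota g = iota e * iota f].

(** * Green's relations *)

Section Green.
Variable S : semigroupType.
Implicit Types x y : S.

(* [x] lies in the principal right (resp. left) ideal [y S^1] (resp.
   [S^1 y]). *)
Definition le_R x y := x = y \/ exists s, x = y * s.
Definition le_L x y := x = y \/ exists s, x = s * y.

Definition green_R x y := le_R x y /\ le_R y x.
Definition green_L x y := le_L x y /\ le_L y x.
Definition green_D x y := exists2 z, green_L x z & green_R z y.

Definition regular_elt x := exists y, x * y * x = x.

Definition regular_Dclass (D : set S) :=
  (exists x, D = [set y | green_D x y]) /\
  (exists2 e, D e & idempotent_elt e).

Lemma green_L_sym x y : green_L x y -> green_L y x.
Proof. by case. Qed.

Lemma le_L_trans x y z : le_L x y -> le_L y z -> le_L x z.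
Proof.
case=> [->//|[s ->]] [->|[t ->]]; first by right; exists s.
by right; exists (s * t); rewrite mulgA.
Qed.

Lemma green_L_trans x y z : green_L x y -> green_L y z -> green_L x z.
Proof.
by move=> [xy yx] [yz zy]; split;
  [exact: le_L_trans xy yz | exact: le_L_trans zy yx].
Qed.

Lemma green_L_mulr x y s : green_L x y -> green_L (x * s) (y * s).
Proof.
case=> xy yx; split; [case: xy => [->|[t ->]] | case: yx => [->|[t ->]]];
  by [left | right; exists t; rewrite mulgA].
Qed.

Lemma green_R_sym x y : green_R x y -> green_R y x.
Proof. by case. Qed.

Lemma le_R_trans x y z : le_R x y -> le_R y z -> le_R x z.
Proof.
case=> [->//|[s ->]] [->|[t ->]]; first by right; exists s.
by right; exists (t * s); rewrite mulgA.
Qed.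

Lemma green_R_trans x y z : green_R x y -> green_R y z -> green_R x z.
Proof.
by move=> [xy yx] [yz zy]; split;
  [exact: le_R_trans xy yz | exact: le_R_trans zy yx].
Qed.

Lemma green_R_mull x y s : green_R x y -> green_R (s * x) (s * y).
Proof.
case=> xy yx; split; [case: xy => [->|[t ->]] | case: yx => [->|[t ->]]];
  by [left | right; exists t; rewrite mulgA].
Qed.

End Green.

(** * Quotient of a semigroup by the congruence generated by a relation *)

Section Presentation.
Variables (S : semigroupType) (rel0 : S -> S -> Prop).

Inductive congr_gen : S -> S -> Prop :=
| congr_rel x y : rel0 x y -> congr_gen x y
| congr_refl x : congr_gen x x
| congr_sym x y : congr_gen x y -> congr_gen y x
| congr_trans y x z : congr_gen x y -> congr_gen y z -> congr_gen x z
| congr_mul x x' y y' :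
    congr_gen x x' -> congr_gen y y' -> congr_gen (x * y) (x' * y').

Definition congr_genb (x y : S) : bool := `[< congr_gen x y >].

Lemma congr_genb_refl : reflexive congr_genb.
Proof. by move=> x; apply/asboolP/congr_refl. Qed.

Lemma congr_genb_sym : symmetric congr_genb.
Proof. by move=> x y; apply/asboolP/asboolP; exact: congr_sym. Qed.

Lemma congr_genb_trans : transitive congr_genb.
Proof.
by move=> y x z /asboolP xy /asboolP yz; apply/asboolP/(congr_trans xy).
Qed.

Canonical congr_genb_equiv :=
  EquivRel congr_genb congr_genb_refl congr_genb_sym congr_genb_trans.

Definition quot_semigroup := {eq_quot congr_genb}.

HB.instance Definition _ := Choice.on quot_semigroup.

Definition quot_pi (x : S) : quot_semigroup := \pi_{eq_quot congr_genb} x.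

Definition quot_repr (a : quot_semigroup) : S :=
  generic_quotient.repr (a : {eq_quot congr_genb}).

Lemma quot_reprK a : quot_pi (quot_repr a) = a.
Proof. exact: reprK. Qed.

Definition quot_mul (a b : quot_semigroup) : quot_semigroup :=
  quot_pi (quot_repr a * quot_repr b).

Lemma quot_piP x y : quot_pi x = quot_pi y <-> congr_gen x y.
Proof.
rewrite /quot_pi; have E := @eqmodP _ congr_genb_equiv x y.
by split=> [/E/asboolP | xy]; last by apply/E/asboolP.
Qed.

Lemma quot_piM : {morph quot_pi : x y / x * y >-> quot_mul x y}.
Proof.
move=> x y; apply/quot_piP; apply: congr_mul;
  by apply/quot_piP; rewrite quot_reprK.
Qed.

Lemma quot_mulA : associative quot_mul.
Proof.
move=> a b c; rewrite -[a]quot_reprK -[b]quot_reprK -[c]quot_reprK.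
by rewrite -!quot_piM mulgA.
Qed.

HB.instance Definition _ := isSemigroup.Build quot_semigroup quot_mulA.

End Presentation.

(** * The free semigroup [E^+] and the free idempotent generated semigroup *)

Section FreeSemigroup.
Variable E : choiceType.

Definition free_semigroup := {w : seq E | w != [::]}.

HB.instance Definition _ := Choice.on free_semigroup.

Lemma word_neq0 (u : seq E) e v : u ++ e :: v != [::].
Proof. by case: u. Qed.

Lemma free_mul_neq0 (w1 w2 : free_semigroup) : val w1 ++ val w2 != [::].
Proof. by case: w1 => -[]. Qed.

(* The nonempty word [u e v], where [u] and [v] range over the free monoid. *)
Definition word (u : seq E) (e : E) (v : seq E) : free_semigroup :=
  Sub (u ++ e :: v) (word_neq0 u e v).

Definition free_mul (w1 w2 : free_semigroup) : free_semigroup :=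
  Sub (val w1 ++ val w2) (free_mul_neq0 w1 w2).

Lemma free_mulA : associative free_mul.
Proof. by move=> x y z; apply: val_inj; rewrite /= catA. Qed.

HB.instance Definition _ := isSemigroup.Build free_semigroup free_mulA.

End FreeSemigroup.

Section IG.
Variables (E : finType) (star : E -> E -> option E).

Definition IG_rel (w1 w2 : free_semigroup E) : Prop :=
  exists e f g, [/\ star e f = Some g,
    w1 = word [::] e [::] * word [::] f [::] & w2 = word [::] g [::]].

Definition IG : semigroupType := quot_semigroup IG_rel.

Definition bar (w : free_semigroup E) : IG := quot_pi IG_rel w.

Definition bar1 (e : E) : IG := bar (word [::] e [::]).

Lemma barM : {morph bar : w1 w2 / w1 * w2}.
Proof. exact: quot_piM. Qed.

(* The letter [e] displayed in [u e v] is a seed of that word. *)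
Definition seed (u : seq E) (e : E) (v : seq E) :=
  green_L (bar (word u e [::])) (bar1 e) /\
  green_R (bar1 e) (bar (word [::] e v)).

End IG.

(** * Principal factors and Rees matrix semigroups *)

(* [None] is the adjoined zero. *)
Definition principal_factor (S : semigroupType) (D : set S) :=
  option {x : S | x \in D}.

Definition pf_mul (S : semigroupType) (D : set S) (a b : principal_factor D) :
    principal_factor D :=
  match a, b with
  | Some x, Some y => insub (val x * val y)
  | _, _ => None
  end.

(* [None] is the zero, both of the semigroup and of [G] with zero adjoined. *)
Definition rees (G : groupType) (I L : Type) := option (I * G * L).

Definition rees_mul (G : groupType) (I L : Type) (P : L -> I -> option G)
    (a b : rees G I L) : rees G I L :=
  match a, b with
  | Some (i, g, l), Some (j, h, m) =>
      if P l j is Some p then Some (i, g * p * h, m) else None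
  | _, _ => None
  end.

(** * Group presentations *)

(* Words in the generators and their inverses: [(x, false)] stands for the
   inverse of [x]. *)
Definition eval_word (X : Type) (G : groupType) (gen : X -> G)
    (w : seq (X * bool)) : G :=
  \prod_(y <- w) (if y.2 then gen y.1 else (gen y.1)^-1).

(* [G] is the group defined by the generators [gen] and the relators [rels]. *)
Definition presents (X : eqType) (G : groupType) (gen : X -> G)
    (rels : seq (seq (X * bool))) :=
  {in rels, forall r, eval_word gen r = 1} /\
  forall (H : groupType) (a : X -> H),
    {in rels, forall r, eval_word a r = 1} ->
    exists! b : G -> H,
      {morph b : x y / x * y} /\ (forall x, b (gen x) = a x).

(** * Coordinatisation of a regular D-class *)

(* [c] indexes the classes of [r] contained in [D], without repetition. *)
Definition indexes_classes (S J : Type) (r : S -> S -> Prop) (D : set S)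
    (c : J -> set S) :=
  injective c /\ range c = [set [set y | r x y] | x in D].

Section IndexesClasses.
Variables (S J : Type) (r : S -> S -> Prop) (D : set S) (c : J -> set S).
Hypotheses (r_sym : forall x y, r x y -> r y x).
Hypotheses (r_trans : forall x y z, r x y -> r y z -> r x z).
Hypothesis c_index : indexes_classes r D c.

Lemma index_class j : exists x, c j = [set y | r x y].
Proof.
have : range c (c j) by exists j.
by rewrite c_index.2 => -[x _ <-]; exists x.
Qed.

Lemma index_class_rel j x y : c j x -> c j y -> r x y.
Proof.
have [z ->] := index_class j => /= zx zy.
exact: r_trans (r_sym zx) zy.
Qed.

Lemma index_class_inj j j' x x' : c j x -> c j' x' -> r x x' -> j = j'.
Proof.
move=> cx cx' xx'; apply: c_index.1.
have [z cz] := index_class j; have [z' cz'] := index_class j'.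
move: cx cx'; rewrite cz cz' /= => zx zx'.
have zz' : r z z' := r_trans zx (r_trans xx' (r_sym zx')).
apply/seteqP; split=> t /=; [exact: r_trans (r_sym zz') | exact: r_trans zz'].
Qed.

End IndexesClasses.

Definition has_idem (S : semigroupType) (I L : Type)
    (Rc : I -> set S) (Lc : L -> set S) (i : I) (l : L) :=
  exists x, [/\ Rc i x, Lc l x & idempotent_elt x].

(* As [D] contains only finitely many idempotents and every R-class and every
   L-class in [D] contains one, the index sets are finite.
   The values [cgen i l] are only meaningful when the intersection of [Rc i]
   and [Lc l] contains an idempotent. *)
Record coordinatisation (S : semigroupType) (D : set S) := Coordinatisation {
  cI : finType;
  cL : finType;
  Rc : cI -> set S;
  Lc : cL -> set S;
  Rc_index : indexes_classes (@green_R S) D Rc;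
  Lc_index : indexes_classes (@green_L S) D Lc;
  cG : groupType;
  cgen : cI -> cL -> cG;
  cP : cL -> cI -> option cG;
  cP_idem : forall i l, has_idem Rc Lc i l -> cP l i = Some (cgen i l)^-1;
  cP_none : forall i l, ~ has_idem Rc Lc i l -> cP l i = None;
  cG_presented :
    exists rels, presents
      (fun x : {il : cI * cL | `[< has_idem Rc Lc il.1 il.2 >]} =>
         cgen (val x).1 (val x).2) rels;
  phi : principal_factor D -> rees cG cI cL;
  phi_bij : bijective phi;
  phi_mul : {morph phi : a b / pf_mul a b >-> rees_mul cP a b};
  phi_cell : forall x i g l, phi (Some x) = Some (i, g, l) ->
    Rc i (val x) /\ Lc l (val x)
}.

Arguments Rc {S D} c.
Arguments Lc {S D} c.
Arguments cgen {S D} c.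
Arguments cP {S D} c.
Arguments phi {S D} c.

(* The indices [(i, l)] for which the generator [cgen C i l] exists. *)
Definition gen_index (S : semigroupType) (D : set S) (C : coordinatisation D)
    (i : cI C) (l : cL C) :=
  has_idem (Rc C) (Lc C) i l.

Arguments gen_index {S D} C i l.

Section PartialMaps.
Variables (E : finType) (star : E -> E -> option E) (D : set (IG star)).
Variable C : coordinatisation D.

Definition tau_rel (e : E) (l l' : cL C) :=
  exists i g h (x y : {x | x \in D}),
    [/\ phi C (Some x) = Some (i, g, l), phi C (Some y) = Some (i, h, l')
      & val x * bar1 star e = val y].

Definition sigma_rel (e : E) (i i' : cI C) :=
  exists l g h (x y : {x | x \in D}),
    [/\ phi C (Some x) = Some (i, g, l), phi C (Some y) = Some (i', h, l)
      & bar1 star e * val x = val y].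

Definition tau (e : E) (l : cL C) : option (cL C) :=
  [pick l' | `[< tau_rel e l l' >]].

Definition sigma (e : E) (i : cI C) : option (cI C) :=
  [pick i' | `[< sigma_rel e i i' >]].

Lemma tau_rel_fun e l m m' : tau_rel e l m -> tau_rel e l m' -> m = m'.
Proof.
move=> [i [g [h [x [y [px py xy]]]]]] [i' [g' [h' [x' [y' [px' py' xy']]]]]].
have sym := @green_L_sym (IG star); have trans := @green_L_trans (IG star).
apply: (index_class_inj sym trans (Lc_index C)
         (phi_cell py).2 (phi_cell py').2).
rewrite -xy -xy'; apply: green_L_mulr.
exact: (index_class_rel sym trans (Lc_index C)
         (phi_cell px).2 (phi_cell px').2).
Qed.

Lemma sigma_rel_fun e i m m' : sigma_rel e i m -> sigma_rel e i m' -> m = m'.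
Proof.
move=> [l [g [h [x [y [px py xy]]]]]] [l' [g' [h' [x' [y' [px' py' xy']]]]]].
have sym := @green_R_sym (IG star); have trans := @green_R_trans (IG star).
apply: (index_class_inj sym trans (Rc_index C)
         (phi_cell py).1 (phi_cell py').1).
rewrite -xy -xy'; apply: green_R_mull.
exact: (index_class_rel sym trans (Rc_index C)
         (phi_cell px).1 (phi_cell px').1).
Qed.

Lemma tauP e l l' : tau e l = Some l' <-> tau_rel e l l'.
Proof.
rewrite /tau; case: pickP => [m /asboolP lm | none]; split.
- by case=> <-.
- by move=> /(tau_rel_fun lm) ->.
- by [].
- by move=> /asboolP; rewrite none.
Qed.

Lemma sigmaP e i i' : sigma e i = Some i' <-> sigma_rel e i i'.
Proof.
rewrite /sigma; case: pickP => [m /asboolP im | none]; split.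
- by case=> <-.
- by move=> /(sigma_rel_fun im) ->.
- by [].
- by move=> /asboolP; rewrite none.
Qed.

(* The zero when [bar w] does not belong to [D]. *)
Definition phibar (w : free_semigroup E) : rees (cG C) (cI C) (cL C) :=
  phi C (insub (bar star w)).

End PartialMaps.

Arguments tau {E star D} C e l.
Arguments sigma {E star D} C e i.
Arguments phibar {E star D} C w.

Definition pfix (T : Type) (alpha : T -> option T) : set T :=
  [set x | alpha x = Some x].

(* Main.v *)
Require Import Defs.
From HB Require Import structures.
From mathcomp Require Import all_boot all_fingroup.
From mathcomp Require Import boolp classical_sets.

(** The idea is that a letter acts on an element of D, as long as the product
    keeps its R-class, like multiplication by an idempotent of D, and the
    coordinates of the idempotents of D are known.

    An idempotent of D in row i and column l is (i, f_il, l), since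
    g p_li g = g forces g = p_li^-1 = f_il ([coord_idem]).  Let x in D lie in
    column l, let a be an idempotent such that x a is R-related to x, and let
    m be the column of x a.  From x a y = x and an inverse z of x one gets the
    idempotent f = a y z x, which is L-related to x and satisfies a f = f
    ([fixed_idem_green_L]).  Thus the row j of f is fixed by the left action
    of a, and because f a f = f the product f a is again an idempotent, in row
    j and column m.  More generally, let f be any idempotent of column l whose
    row j is fixed by a.  Then x = x f, so x a = x (f a) is computed by the
    sandwich matrix: the group coordinate of x is multiplied on the right by
    f_jl^-1 f_jm ([coord_mulr]).  The left-right dual is [coord_mull].

    If e is R-related to e v, then every nonempty prefix of e v is squeezed
    between the two and is R-related to e.  Hence each letter of v acts as
    above, and the contributions accumulate to the group coordinate of e v
    ([coord_right_product]); dually for u e ([coord_left_product]).  Finally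
    u e v = (u e)(e v) in the semigroup, and the product of the coordinates
    (i_1, A f_il, l) and (i, f_il B, l_n) is (i_1, A f_il B, l_n). *)

Set Implicit Arguments.
Unset Strict Implicit.
Unset Printing Implicit Defensive.

Local Open Scope group_scope.
Local Open Scope classical_set_scope.

(** * Green's relations and idempotents *)

Section Green.
Variable S : semigroupType.
Implicit Types x y z a e f : S.

Lemma le_R_mulr x a : le_R (x * a) x.
Proof. by right; exists a. Qed.

Lemma le_L_mull a x : le_L (a * x) x.
Proof. by right; exists a. Qed.

Lemma green_R_refl x : green_R x x.
Proof. by split; left. Qed.

Lemma green_L_refl x : green_L x x.
Proof. by split; left. Qed.

Lemma idem_mull f x : idempotent_elt f -> le_R x f -> f * x = x.
Proof. by move=> ff [->//|[s ->]]; rewrite mulgA ff. Qed.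

Lemma idem_mulr f x : idempotent_elt f -> le_L x f -> x * f = x.
Proof. by move=> ff [->//|[s ->]]; rewrite -mulgA ff. Qed.

Lemma fix_le_R a x y : a * x = x -> le_R y x -> a * y = y.
Proof. by move=> ax [->//|[s ->]]; rewrite mulgA ax. Qed.

Lemma fix_le_L a x y : x * a = x -> le_L y x -> y * a = y.
Proof. by move=> xa [->//|[s ->]]; rewrite -mulgA xa. Qed.

Lemma green_R_idem_regular x e :
  idempotent_elt e -> green_R x e -> regular_elt x.
Proof.
move=> ee [xe [ex|[t et]]]; last by exists t; rewrite -et idem_mull.
by exists e; rewrite -ex !ee.
Qed.

Lemma green_L_idem_regular x e :
  idempotent_elt e -> green_L x e -> regular_elt x.
Proof.
move=> ee [xe [ex|[t et]]]; last by exists t; rewrite -mulgA -et idem_mulr.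
by exists e; rewrite -ex !ee.
Qed.

(** If x a y = x and x z x = x, then f = a y z x satisfies x f = x, and hence
    f f = (a y z) (x f) = f.  This f gives the row that is fixed by a and has
    an idempotent in the column of x. *)
Lemma fixed_idem_green_L x a : idempotent_elt a -> regular_elt x ->
  green_R x (x * a) -> exists f, [/\ idempotent_elt f, a * f = f & green_L f x].
Proof.
move=> aa [z xzx] [xxa _].
have [y xay] : exists y, x * a * y = x.
  case: xxa => [xa|[y xy]]; last by exists y.
  by exists a; rewrite -xa.
have xf : x * (a * y * (z * x)) = x by rewrite !mulgA xay.
exists (a * y * (z * x)); split.
- by rewrite /idempotent_elt -[LHS]mulgA -[z * x * _]mulgA xf.
- by rewrite !mulgA aa.
- split; first by rewrite mulgA; exact: le_L_mull.
  by right; exists x.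
Qed.

(** The dual witness is f = x z y a, where y a x = x and x z x = x. *)
Lemma fixed_idem_green_R x a : idempotent_elt a -> regular_elt x ->
  green_L x (a * x) -> exists f, [/\ idempotent_elt f, f * a = f & green_R f x].
Proof.
move=> aa [z xzx] [xax _].
have [y yax] : exists y, y * (a * x) = x.
  case: xax => [xa|[y xy]]; last by exists y.
  by exists a; rewrite -xa.
have fx : x * z * (y * a) * x = x by rewrite -!mulgA yax mulgA.
exists (x * z * (y * a)); split.
- rewrite /idempotent_elt -{1}[x * z * (y * a)]mulgA !mulgA in fx *.
  by rewrite fx.
- by rewrite -!mulgA aa.
- split; first by rewrite -mulgA; exact: le_R_mulr.
  by right; exists x.
Qed.

(** The principal right ideals of the prefixes decrease along the product, so
    they all coincide as soon as the first and the last one do. *)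
Lemma prefix_green_R (X : nat -> S) (a : nat -> S) l :
  (forall q, X q.+1 = X q * a q.+1) -> green_R (X 0) (X l) ->
  forall q, (q <= l)%N -> green_R (X q) (X 0).
Proof.
move=> XS [X0l _] q ql.
have mono r s : le_R (X (r + s)%N) (X r).
  elim: s => [|s IHs]; first by rewrite addn0; left.
  by rewrite addnS XS; exact: le_R_trans (le_R_mulr _ _) IHs.
split; first exact: (mono 0 q).
by apply: le_R_trans X0l _; rewrite -(subnKC ql); exact: mono.
Qed.

Lemma suffix_green_L (Y : nat -> S) (a : nat -> S) k :
  (forall p, (p <= k)%N -> Y p = a p * Y p.+1) -> green_L (Y 1%N) (Y k.+1) ->
  forall p, (1 <= p <= k.+1)%N -> green_L (Y p) (Y k.+1).
Proof.
move=> YS [_ Yk1] p /andP[p1 pk].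
have mono r s : (r <= s <= k.+1)%N -> le_L (Y r) (Y s).
  case/andP=> /subnKC <-; elim: (s - r)%N => [|d IHd] rs.
    by rewrite addn0; left.
  rewrite addnS in rs *; apply: le_L_trans (IHd (ltnW rs)) _.
  by rewrite YS //; exact: le_L_mull.
split; first by apply: mono; rewrite pk leqnn.
by apply: le_L_trans Yk1 _; apply: mono; rewrite p1 pk.
Qed.

Lemma green_D_R x y z : green_D x y -> green_R y z -> green_D x z.
Proof. by case=> t xt ty yz; exists t => //; exact: green_R_trans ty yz. Qed.

(** Half of the commutation of L and R: if z = b y, then b x completes the
    square, since left translation by b is inverted on the R-class of y by any
    c with y = c z. *)
Lemma green_LR_comm x y z : green_R x y -> green_L y z ->
  exists2 t, green_L x t & green_R t z.
Proof.
move=> [xy yx] [yz zy].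
case: zy => [->|[b zby]]; first by exists x; [exact: green_L_refl|].
exists (b * x).
  case: yz => [yz|[c ycz]].
    split; last exact: le_L_mull.
    have ybx : b * y = y by rewrite -zby.
    by rewrite (fix_le_R ybx xy); left.
  split; last exact: le_L_mull.
  have cby : c * b * y = y by rewrite -mulgA -zby -ycz.
  by right; exists c; rewrite mulgA (fix_le_R cby xy).
by rewrite zby; apply: green_R_mull.
Qed.

Lemma green_D_L x y z : green_D x y -> green_L y z -> green_D x z.
Proof.
case=> t xt ty yz; have [s ts sz] := green_LR_comm ty yz.
by exists s => //; exact: green_L_trans xt ts.
Qed.

End Green.

(** * Computing in the coordinates *)

Section Coordinates.
Variables (S : semigroupType) (D : set S).
Hypothesis D_regular : regular_Dclass D.
Variable C : coordinatisation D.
Implicit Types (x y a f : S) (i j : cI C) (l m : cL C) (c : cG C).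

Definition coord x : rees (cG C) (cI C) (cL C) := phi C (insub x).

Lemma Dclass_green_R x y : D x -> green_R x y -> D y.
Proof. by have [[z ->] _] := D_regular; exact: green_D_R. Qed.

Lemma Dclass_green_L x y : D x -> green_L x y -> D y.
Proof. by have [[z ->] _] := D_regular; exact: green_D_L. Qed.

Lemma Rc_sub i x : Rc C i x -> D x.
Proof.
move=> ix; have : range (Rc C) (Rc C i) by exists i.
rewrite (Rc_index C).2 => -[y Dy yi]; apply: Dclass_green_R Dy _.
by move: ix; rewrite -yi.
Qed.

Lemma Lc_sub l x : Lc C l x -> D x.
Proof.
move=> lx; have : range (Lc C) (Lc C l) by exists l.
rewrite (Lc_index C).2 => -[y Dy yl]; apply: Dclass_green_L Dy _.
by move: lx; rewrite -yl.
Qed.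

Lemma Rc_green i x y : Rc C i x -> (Rc C i y <-> green_R x y).
Proof.
have [z ->] := index_class (Rc_index C) i => /= zx; split=> [zy|].
  exact: green_R_trans (green_R_sym zx) zy.
exact: green_R_trans zx.
Qed.

Lemma Lc_green l x y : Lc C l x -> (Lc C l y <-> green_L x y).
Proof.
have [z ->] := index_class (Lc_index C) l => /= zx; split=> [zy|].
  exact: green_L_trans (green_L_sym zx) zy.
exact: green_L_trans zx.
Qed.

Lemma Rc_inj i j x : Rc C i x -> Rc C j x -> i = j.
Proof.
move=> ix jx; apply: (index_class_inj (@green_R_sym S) (@green_R_trans S)
  (Rc_index C) ix jx); exact: green_R_refl.
Qed.

Lemma Lc_inj l m x : Lc C l x -> Lc C m x -> l = m.
Proof.
move=> lx mx; apply: (index_class_inj (@green_L_sym S) (@green_L_trans S)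
  (Lc_index C) lx mx); exact: green_L_refl.
Qed.

(** The isomorphism preserves zero: as phi is onto, phi 0 = phi (0 a) = (phi 0)
    0 = 0 for the element a that is mapped to 0. *)
Lemma phi0 : phi C None = None.
Proof.
have [psi _ psiK] := phi_bij C.
have := phi_mul C None (psi None); rewrite psiK /= => ->.
by case: (phi C None) => [[[]]|].
Qed.

Lemma coord_class x i c l : coord x = Some (i, c, l) -> Rc C i x /\ Lc C l x.
Proof.
rewrite /coord; case: insubP => [u _ <-|_]; last by rewrite phi0.
exact: phi_cell.
Qed.

Lemma coordE x : D x -> exists i c l, coord x = Some (i, c, l).
Proof.
move=> Dx; rewrite /coord; case: insubP => [u _ ux|]; last by rewrite mem_set.
case Eu: (phi C (Some u)) => [[[i c] l]|]; first by exists i, c, l.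
by have := bij_inj (phi_bij C) (etrans Eu (esym phi0)).
Qed.

Lemma coord_in x i l :
  Rc C i x -> Lc C l x -> exists c, coord x = Some (i, c, l).
Proof.
move=> ix lx; have [j [c [m xE]]] := coordE (Rc_sub ix).
have [jx mx] := coord_class xE; exists c.
by rewrite (Rc_inj ix jx) (Lc_inj lx mx).
Qed.

Lemma coord_insub x i c l : coord x = Some (i, c, l) ->
  exists2 u : {x | x \in D}, val u = x & phi C (Some u) = Some (i, c, l).
Proof.
by rewrite /coord; case: insubP => [u _ <-|_]; [exists u | rewrite phi0].
Qed.

Lemma coordM x y i c l j d m : coord x = Some (i, c, l) ->
    coord y = Some (j, d, m) -> gen_index C j l ->
  coord (x * y) = Some (i, c * (cgen C j l)^-1 * d, m).
Proof.
move=> /coord_insub[u <- uE] /coord_insub[v <- vE] jl.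
have := phi_mul C (Some u) (Some v).
by rewrite /coord /= uE vE /= (cP_idem jl).
Qed.

(** Comparing coordinates in f f = f gives c f_il^-1 c = c. *)
Lemma coord_idem f i l : idempotent_elt f -> Rc C i f -> Lc C l f ->
  coord f = Some (i, cgen C i l, l).
Proof.
move=> ff fi fl; have [c fE] := coord_in fi fl.
have il : gen_index C i l by exists f.
have := coordM fE fE il; rewrite ff fE => -[] /esym cc.
congr (Some (_, _, _)); apply: (mulIg (cgen C i l)^-1).
by rewrite mulgV; apply: (mulIg c); rewrite cc mul1g.
Qed.

(** The idempotent f a behind the displacement from column l to column m: it
    is idempotent because f a f = f f, its row is that of f, and it lies in
    column m because L is a right congruence and f L x. *)
Lemma fixed_idem_box x a f i c l j d m : coord x = Some (i, c, l) ->
    coord (x * a) = Some (i, d, m) -> idempotent_elt f -> a * f = f ->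
    Rc C j f -> Lc C l f ->
  [/\ idempotent_elt (f * a), Rc C j (f * a) & Lc C m (f * a)].
Proof.
move=> xE xaE ff af jf lf; have [_ lx] := coord_class xE.
have [_ mxa] := coord_class xaE.
have faf : f * a * f = f by rewrite -mulgA af ff.
split; first by rewrite /idempotent_elt mulgA faf.
  by apply/(Rc_green _ jf); split; [right; exists f | exact: le_R_mulr].
by apply/(Lc_green _ mxa)/green_L_mulr/(Lc_green _ lx).
Qed.

(** Since x = x f, the product x a is x (f a), where both the sandwich entry
    and the coordinates of the idempotent f a are known. *)
Lemma coord_mulr x a f i c l j d m : coord x = Some (i, c, l) ->
    coord (x * a) = Some (i, d, m) -> idempotent_elt f -> a * f = f ->
    Rc C j f -> Lc C l f ->
  d = c * ((cgen C j l)^-1 * cgen C j m).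
Proof.
move=> xE xaE ff af jf lf.
have [fafa jfa mfa] := fixed_idem_box xE xaE ff af jf lf.
have [_ lx] := coord_class xE.
have xf : x * f = x by apply: idem_mulr => //; have [] := (Lc_green x lf).1 lx.
have jl : gen_index C j l by exists f.
have := coordM xE (coord_idem fafa jfa mfa) jl.
by rewrite mulgA xf xaE => -[->]; rewrite mulgA.
Qed.

Lemma fixed_idem_box_left x a f i c l j d m : coord x = Some (i, c, l) ->
    coord (a * x) = Some (j, d, l) -> idempotent_elt f -> f * a = f ->
    Rc C i f -> Lc C m f ->
  [/\ idempotent_elt (a * f), Rc C j (a * f) & Lc C m (a * f)].
Proof.
move=> xE axE ff fa if_ mf; have [ix _] := coord_class xE.
have [jax _] := coord_class axE.
have faf : f * (a * f) = f by rewrite mulgA fa ff.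
split; first by rewrite /idempotent_elt -mulgA faf.
  by apply/(Rc_green _ jax)/green_R_mull/(Rc_green _ ix).
by apply/(Lc_green _ mf); split; [right; exists f | exact: le_L_mull].
Qed.

(** Dually a x = (a f) x, with a f an idempotent. *)
Lemma coord_mull x a f i c l j d m : coord x = Some (i, c, l) ->
    coord (a * x) = Some (j, d, l) -> idempotent_elt f -> f * a = f ->
    Rc C i f -> Lc C m f ->
  d = cgen C j m * (cgen C i m)^-1 * c.
Proof.
move=> xE axE ff fa if_ mf.
have [afaf jaf maf] := fixed_idem_box_left xE axE ff fa if_ mf.
have [ix _] := coord_class xE.
have fx : f * x = x by apply: idem_mull => //; have [] := (Rc_green x if_).1 ix.
have im : gen_index C i m by exists f.
have := coordM (coord_idem afaf jaf maf) xE im.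
by rewrite -mulgA fx axE => -[->].
Qed.

End Coordinates.

Arguments coord {S D} C x.

(** * The partial maps on row and column indices *)

Section PartialMaps.
Variables (E : finType) (star : E -> E -> option E).
Hypothesis star_biordered : is_biordered star.
Variable D : set (IG star).
Hypothesis D_regular : regular_Dclass D.
Variable C : coordinatisation D.
Implicit Types (x y f : IG star) (e : E) (i j : cI C) (l m : cL C).

Lemma bar1_idem e : idempotent_elt (bar1 star e).
Proof.
have [S [iota [_ riota starE]]] := star_biordered.
have ee : iota e * iota e = iota e.
  have : range iota (iota e) by exists e.
  by rewrite riota.
rewrite /idempotent_elt /bar1 -barM; apply/quot_piP/congr_rel.
by exists e, e, e; split => //; apply/starE; split; [constructor 1 | rewrite ee].
Qed.

(** The letter e can be doubled because e is idempotent and e v lies in its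
    right ideal.  The empty u is separate, as it has no image in the
    semigroup to split off. *)
Lemma seed_factorE u e v : seed star u e v ->
  bar star (word u e v) = bar star (word u e [::]) * bar star (word [::] e v).
Proof.
case=> _ [_ ve]; have eev := idem_mull (bar1_idem e) ve.
case: u => [//|a u].
have wordE t : word (a :: u) e t = word [::] a u * word [::] e t.
  exact: val_inj.
by rewrite !wordE 2!barM -mulgA -/(bar1 star e) eev.
Qed.

Lemma tau_coord x e i c l d m : coord C x = Some (i, c, l) ->
  coord C (x * bar1 star e) = Some (i, d, m) -> tau C e l = Some m.
Proof.
move=> /coord_insub[u ux uE] /coord_insub[v vx vE]; apply/tauP.
by exists i, c, d, u, v; rewrite ux vx.
Qed.

Lemma sigma_coord x e i c l j d : coord C x = Some (i, c, l) ->
  coord C (bar1 star e * x) = Some (j, d, l) -> sigma C e i = Some j.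
Proof.
move=> /coord_insub[u ux uE] /coord_insub[v vx vE]; apply/sigmaP.
by exists l, c, d, u, v; rewrite ux vx.
Qed.

(** Fixing the row j only says that e x stays in the R-class of x; as e is
    idempotent it then fixes every element of that row. *)
Lemma pfix_sigmaP e j f : Rc C j f ->
  pfix (sigma C e) j <-> bar1 star e * f = f.
Proof.
move=> jf; split.
  move=> /sigmaP[l [c [d [u [v [uE vE uv]]]]]].
  have [ju _] := phi_cell uE; have [jv _] := phi_cell vE.
  apply: (fix_le_R (x := val v)); first by rewrite -uv mulgA bar1_idem.
  by have [] := (Rc_green f jv).1 jf.
move=> ef; have [i [c [l fE]]] := coordE C (Rc_sub D_regular jf).
have [if_ _] := coord_class fE; rewrite (Rc_inj if_ jf) in fE.
by apply: (sigma_coord (d := c) fE); rewrite ef.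
Qed.

Lemma pfix_tauP e m f : Lc C m f ->
  pfix (tau C e) m <-> f * bar1 star e = f.
Proof.
move=> mf; split.
  move=> /tauP[i [c [d [u [v [uE vE uv]]]]]].
  have [_ mv] := phi_cell vE.
  apply: (fix_le_L (x := val v)); first by rewrite -uv -mulgA bar1_idem.
  by have [] := (Lc_green f mv).1 mf.
move=> fe; have [i [c [l fE]]] := coordE C (Lc_sub D_regular mf).
have [_ lf] := coord_class fE; rewrite (Lc_inj lf mf) in fE.
by apply: (tau_coord (d := c) fE); rewrite fe.
Qed.

(** The elements X q are meant to be the prefixes e h_1 ... h_q.  They all lie
    in one R-class, so only the column changes, and [coord_mulr] gives the
    factor contributed by each letter. *)
Lemma coord_right_product (X : nat -> IG star) (h : nat -> E) (n : nat) i c l :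
    (forall q, X q.+1 = X q * bar1 star (h q.+1)) ->
    idempotent_elt (X 0) -> green_R (X 0) (X n) ->
    coord C (X 0) = Some (i, c, l) ->
  exists lam : nat -> cL C,
    [/\ lam 0%N = l,
        forall q, (1 <= q <= n)%N -> tau C (h q) (lam q.-1) = Some (lam q),
        forall q, (1 <= q <= n)%N -> exists j,
          [/\ pfix (sigma C (h q)) j, gen_index C j (lam q.-1)
            & gen_index C j (lam q)]
      & forall jj : nat -> cI C,
          (forall q, (1 <= q <= n)%N ->
             [/\ pfix (sigma C (h q)) (jj q), gen_index C (jj q) (lam q.-1)
               & gen_index C (jj q) (lam q)]) ->
          coord C (X n) = Some (i,
            c * \prod_(1 <= q < n.+1)
                  ((cgen C (jj q) (lam q.-1))^-1 * cgen C (jj q) (lam q)),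
            lam n)].
Proof.
move=> XS X00 X0n X0E.
have XR := prefix_green_R (a := bar1 star \o h) XS X0n.
(* The default l is never met, since every X q with q <= n lies in D. *)
pose lam q := if coord C (X q) is Some (_, _, m) then m else l.
have XE q : (q <= n)%N -> exists d, coord C (X q) = Some (i, d, lam q).
  move=> qn; have [i0 _] := coord_class X0E.
  have iq : Rc C i (X q) by apply/(Rc_green _ i0)/green_R_sym/XR.
  have [j [d [m qE]]] := coordE C (Rc_sub D_regular iq).
  have [jq _] := coord_class qE; exists d.
  by rewrite /lam qE (Rc_inj jq iq).
have lam0 : lam 0%N = l by rewrite /lam X0E.
exists lam; split=> // [[//|q] /= qn|[//|q] /= qn|jj jjP].
- have [d dE] := XE q (ltnW qn); have [d' dE'] := XE _ qn.
  by rewrite XS in dE'; exact: tau_coord dE dE'.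
- have [d dE] := XE q (ltnW qn); have [d' dE'] := XE _ qn.
  have Xqreg := green_R_idem_regular X00 (XR q (ltnW qn)).
  have XqR : green_R (X q) (X q * bar1 star (h q.+1)).
    by rewrite -XS; exact: green_R_trans (XR q (ltnW qn)) (green_R_sym (XR _ qn)).
  have [f [ff hf fX]] := fixed_idem_green_L (bar1_idem _) Xqreg XqR.
  have [_ lq] := coord_class dE.
  have lf : Lc C (lam q) f by apply/(Lc_green _ lq)/green_L_sym.
  have [j [b [m fE]]] := coordE C (Lc_sub D_regular lf).
  have [jf _] := coord_class fE; exists j.
  rewrite XS in dE'; have [hI jfh lfh] := fixed_idem_box dE dE' ff hf jf lf.
  split; first exact/(pfix_sigmaP _ jf).
  + by exists f.
  + by exists (f * bar1 star (h q.+1)).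
suff XP (m : nat) : (m <= n)%N -> coord C (X m) = Some (i,
    c * \prod_(1 <= q < m.+1)
          ((cgen C (jj q) (lam q.-1))^-1 * cgen C (jj q) (lam q)), lam m).
  exact: XP.
elim: m => [|q IHq] qn; first by rewrite big_geq // mulg1 lam0.
have [d dE] := XE _ qn; rewrite dE.
have [jfix [f [jf lf ff]] _] := jjP q.+1 qn.
have hf := (pfix_sigmaP _ jf).1 jfix.
rewrite XS in dE.
rewrite (coord_mulr D_regular (IHq (ltnW qn)) dE ff hf jf lf).
by rewrite [in RHS]big_nat_recr //= !mulgA.
Qed.

(** Dual of [coord_right_product], for the suffixes Y p = g_p ... g_n e; they
    are indexed so that Y (n + 1) is the seed. *)
Lemma coord_left_product (Y : nat -> IG star) (g : nat -> E) (n : nat) i c l :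
    (forall p, (p <= n)%N -> Y p = bar1 star (g p) * Y p.+1) ->
    idempotent_elt (Y n.+1) -> green_L (Y 1%N) (Y n.+1) ->
    coord C (Y n.+1) = Some (i, c, l) ->
  exists ii : nat -> cI C,
    [/\ ii n.+1 = i,
        forall p, (1 <= p <= n)%N -> sigma C (g p) (ii p.+1) = Some (ii p),
        forall p, (1 <= p <= n)%N -> exists mu,
          [/\ pfix (tau C (g p)) mu, gen_index C (ii p) mu
            & gen_index C (ii p.+1) mu]
      & forall mu : nat -> cL C,
          (forall p, (1 <= p <= n)%N ->
             [/\ pfix (tau C (g p)) (mu p), gen_index C (ii p) (mu p)
               & gen_index C (ii p.+1) (mu p)]) ->
          coord C (Y 1%N) = Some (ii 1%N,
            (\prod_(1 <= p < n.+1)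
               (cgen C (ii p) (mu p) * (cgen C (ii p.+1) (mu p))^-1)) * c,
            l)].
Proof.
move=> YS Ynn Y1n YnE.
have YL := suffix_green_L (a := bar1 star \o g) YS Y1n.
(* The default i is never met for 1 <= p <= n + 1. *)
pose ii p := if coord C (Y p) is Some (j, _, _) then j else i.
have YE p : (1 <= p <= n.+1)%N -> exists d, coord C (Y p) = Some (ii p, d, l).
  move=> pn; have [_ ln] := coord_class YnE.
  have lp : Lc C l (Y p) by apply/(Lc_green _ ln)/green_L_sym/YL.
  have [j [d [m pE]]] := coordE C (Lc_sub D_regular lp).
  have [_ mp] := coord_class pE; exists d.
  by rewrite /ii pE (Lc_inj mp lp).
have iin : ii n.+1 = i by rewrite /ii YnE.
exists ii; split=> // [p /andP[p1 pn]|p /andP[p1 pn]|mu muP].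
- have [d dE] : exists d, _ := YE p.+1 pn.
  have [d' dE'] := YE p (introT andP (conj p1 (leqW pn))).
  by rewrite YS // in dE'; exact: sigma_coord dE dE'.
- have [d dE] : exists d, _ := YE p.+1 pn.
  have p1n : (1 <= p <= n.+1)%N by rewrite p1 leqW.
  have [d' dE'] := YE p p1n.
  have Ypreg := green_L_idem_regular Ynn (YL p.+1 pn).
  have YpL : green_L (Y p.+1) (bar1 star (g p) * Y p.+1).
    by rewrite -YS //; exact: green_L_trans (YL p.+1 pn) (green_L_sym (YL p p1n)).
  have [f [ff fg fY]] := fixed_idem_green_R (bar1_idem _) Ypreg YpL.
  have [ip _] := coord_class dE.
  have if_ : Rc C (ii p.+1) f by apply/(Rc_green _ ip)/green_R_sym.
  have [j [b [m fE]]] := coordE C (Rc_sub D_regular if_).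
  have [_ mf] := coord_class fE; exists m.
  rewrite YS // in dE'.
  have [gI igf mgf] := fixed_idem_box_left dE dE' ff fg if_ mf.
  split; first exact/(pfix_tauP _ mf).
  + by exists (bar1 star (g p) * f).
  + by exists f.
(* The product grows downwards from the seed: induct on the number d of
   letters already multiplied. *)
suff YP d : (d <= n)%N -> coord C (Y (n.+1 - d)%N) = Some (ii (n.+1 - d)%N,
    (\prod_(n.+1 - d <= p < n.+1)
       (cgen C (ii p) (mu p) * (cgen C (ii p.+1) (mu p))^-1)) * c, l).
  by have := YP n (leqnn n); rewrite subSnn.
elim: d => [|d IHd] dn; first by rewrite subn0 big_geq // mul1g iin.
have {IHd} := IHd (ltnW dn).
have dS : (n.+1 - d = (n.+1 - d.+1).+1)%N by rewrite subSS subSn // ltnW.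
have p1 : (1 <= n.+1 - d.+1 <= n)%N by rewrite subSS subn_gt0 dn leq_subr.
move: (n.+1 - d.+1)%N dS p1 => p -> /andP[p1 pn] IHp.
have p1n : (1 <= p <= n.+1)%N by rewrite p1 leqW.
have [b bE] := YE p p1n; rewrite bE.
have [mfix _ [f [if_ mf ff]]] := muP p (introT andP (conj p1 pn)).
have fg := (pfix_tauP _ mf).1 mfix.
rewrite YS // in bE.
rewrite (coord_mull D_regular IHp bE ff fg if_ mf).
by rewrite [in RHS]big_ltn // !mulgA.
Qed.

End PartialMaps.

(** * The coordinates of a word with a seed *)

(* Conventions: [lam 0] is lambda and [ii k.+1] is i, so that for an empty
   left (right) factor the first (last) coordinate is i (lambda). *)
Theorem theorem4p3 (E : finType) (star : E -> E -> option E)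
    (star_biordered : is_biordered star)
    (D : set (IG star)) (D_regular : regular_Dclass D)
    (C : coordinatisation D)
    (w : free_semigroup E) (w_in_D : D (bar star w))
    (w_regular : regular_elt (bar star w))
    (k l : nat) (g h : nat -> E) (e : E) (i : cI C) (lambda : cL C)
    (e_R : Rc C i (bar1 star e)) (e_L : Lc C lambda (bar1 star e))
    (w_fact : w = word [seq g p | p <- iota 1 k] e [seq h q | q <- iota 1 l])
    (w_seed : seed star [seq g p | p <- iota 1 k] e [seq h q | q <- iota 1 l]) :
  exists (ii : nat -> cI C) (lam : nat -> cL C),
    [/\ ii k.+1 = i,
        (forall p, (1 <= p <= k)%N ->
           sigma C (g p) (ii p.+1) = Some (ii p)),
        lam 0%N = lambda
      & (forall q, (1 <= q <= l)%N ->
           tau C (h q) (lam q.-1) = Some (lam q))] /\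
    [/\ (forall p, (1 <= p <= k)%N -> exists mu,
           [/\ pfix (tau C (g p)) mu,
               gen_index C (ii p) mu
             & gen_index C (ii p.+1) mu]),
        (forall q, (1 <= q <= l)%N -> exists j,
           [/\ pfix (sigma C (h q)) j,
               gen_index C j (lam q.-1)
             & gen_index C j (lam q)])
      & forall (mu : nat -> cL C) (jj : nat -> cI C),
          (forall p, (1 <= p <= k)%N ->
             [/\ pfix (tau C (g p)) (mu p),
                 gen_index C (ii p) (mu p)
               & gen_index C (ii p.+1) (mu p)]) ->
          (forall q, (1 <= q <= l)%N ->
             [/\ pfix (sigma C (h q)) (jj q),
                 gen_index C (jj q) (lam q.-1)
               & gen_index C (jj q) (lam q)]) ->
          phibar C w =
            Some (ii 1%N,
                  (\prod_(1 <= p < k.+1)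
                     (cgen C (ii p) (mu p) * (cgen C (ii p.+1) (mu p))^-1)) *
                  cgen C i lambda *
                  (\prod_(1 <= q < l.+1)
                     ((cgen C (jj q) (lam q.-1))^-1 * cgen C (jj q) (lam q))),
                  lam l)].
Proof.
have ee := bar1_idem star_biordered e.
have eE := coord_idem D_regular ee e_R e_L.
have [uL vR] := w_seed.
pose X q := bar star (word [::] e [seq h r | r <- iota 1 q]).
pose Y p := bar star (word [seq g r | r <- iota p (k.+1 - p)] e [::]).
have XS q : X q.+1 = X q * bar1 star (h q.+1).
  rewrite /X -{1}(addn1 q) iotaD map_cat add1n /bar1 -barM.
  by congr (bar _ _); apply: val_inj.
have YS p : (p <= k)%N -> Y p = bar1 star (g p) * Y p.+1.
  move=> pk; rewrite /Y /bar1 -barM; congr (bar _ _); apply: val_inj => /=.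
  by rewrite subSn.
have Yk : Y k.+1 = bar1 star e by rewrite /Y subnn.
have [lam [lam0 lamS lamj lamP]] := coord_right_product star_biordered D_regular
  (i := i) (c := cgen C i lambda) (l := lambda) XS ee vR eE.
have Y1k : green_L (Y 1%N) (Y k.+1) by rewrite Yk /Y subn1.
have [ii [iik iiS iimu iiP]] : exists ii : nat -> cI C, _ :=
  coord_left_product star_biordered D_regular
  (i := i) (c := cgen C i lambda) (l := lambda) YS
  (etrans (congr1 (fun x => x * x) Yk) (etrans ee (esym Yk))) Y1k
  (etrans (congr1 (coord C) Yk) eE).
exists ii, lam; do 2!split => //; move=> mu jj muP jjP.
have wE : bar star w = Y 1%N * X l by rewrite w_fact /Y subn1 -seed_factorE.
have il : gen_index C i lambda by exists (bar1 star e).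
rewrite /phibar -/(coord C _) wE (coordM (iiP _ muP) (lamP _ jjP) il).
by rewrite -!mulgA mulVKg !mulgA.
Qed.
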